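(* Let $X$ be a compact Kähler manifold of dimension $n$ and let $\Omega\in H^{n-d,n-d}(X,\mathbb{R})$ be a strictly Lorentzian class of dimension $d$. Then for any fixed $1\le k\le d-1$, the map $\alpha\mapsto\alpha^k\cdot\Omega$ is injective on the cone consisting of nef classes on $X$ that are big on $\Omega$.
   Context: A class in $H^{1,1}(X,\mathbb{R})$ is nef if it lies in the closure of the cone $\mathrm{Amp}^1(X)$ of Kähler classes. For $d\ge2$, a class $\Omega\in H^{n-d,n-d}(X,\mathbb{R})$ is called a strictly Lorentzian class of dimension $d$ if (i) $\omega_1\cdot\ldots\cdot\omega_d\cdot\Omega>0$ for all $\omega_1,\dots,\omega_d\in \mathrm{Amp}^1(X)$, and (ii) for all $\omega_1,\dots,\omega_{d-2}\in \mathrm{Amp}^1(X)$ the bilinear form $(\xi,\eta)\mapsto\xi\cdot\eta\cdot\omega_1\cdot\ldots\cdot\omega_{d-2}\cdot\Omega$ on $H^{1,1}(X,\mathbb{R})$ has Lorentzian signature $(+,-,\dots,-)$. A nef class $\alpha$ is big on $\Omega$ if $|\alpha|_\Omega=\alpha^d\cdot\Omega>0$. *)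

(* Defs.v *)
From HB Require Import structures.
From mathcomp Require Import all_boot all_order all_algebra.
From mathcomp Require Import all_classical all_reals all_analysis.
From mathcomp Require Import complex ring.
Set Implicit Arguments.
Unset Strict Implicit.
Unset Printing Implicit Defensive.
Import Order.TTheory GRing.Theory Num.Theory.
Import numFieldNormedType.Exports.
Local Open Scope classical_set_scope.
Local Open Scope ring_scope.
Local Open Scope quotient_scope.

Section SmoothFunctions.
Context (R : realType) (m : nat).
Implicit Types (U : set 'rV[R]_m) (f g : 'rV[R]_m -> R).

Fixpoint Ck (k : nat) U f : Prop :=
  (forall z, U z -> {for z, continuous f}) /\
  if k is k'.+1 then
    forall v, (forall z, U z -> derivable f z v) /\
              Ck k' U (fun z => 'D_v f z)
  else True.

Definition smooth_on U f := forall k, Ck k U f.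

Lemma Ck_ext k U f g : open U -> (forall z, U z -> f z = g z) ->
  Ck k U f -> Ck k U g.
Proof.
elim: k f g => [|k IH] f g oU fg /= [cf df].
all: have nfg z : U z -> \forall y \near z, f y = g y.
1,3: by move=> Uz; near=> y; apply: fg; near: y; exact: open_nbhs_nbhs.
all: have cg z : U z -> {for z, continuous g}.
1,3: move=> Uz; rewrite /prop_for /continuous_at -(fg z Uz);
  exact: cvg_trans (near_eq_cvg (nfg z Uz)) (cf z Uz).
- by [].
split=> // v; have [dfi Ci] := df v; split.
  move=> z Uz; exact: near_eq_derivable (nfg z Uz) (dfi z Uz).
apply: IH Ci => // z Uz; exact: near_eq_derive (nfg z Uz).
Unshelve. all: by end_near. Qed.

Lemma CkW k U f : Ck k.+1 U f -> Ck k U f.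
Proof.
elim: k f => [|k IH] f /= [cf df]; split=> // i.
by have [dfi Ci] := df i; split=> //; apply: IH.
Qed.

Lemma Ck_cst k U c : Ck k U (fun=> c).
Proof.
elim: k c => [|k IH] c /=; (split=> [z _|]; first exact: cst_continuous) => // i.
split=> [z _|]; first exact: derivable_cst.
suff -> : (fun z => 'D_i (cst c) z) = (fun=> 0) by apply: IH.
by apply/funext => z; rewrite derive_cst.
Qed.

Lemma CkD k U f g : open U -> Ck k U f -> Ck k U g -> Ck k U (f + g).
Proof.
move=> oU; elim: k f g => [|k IH] f g /= [cf df] [cg dg].
all: split=> [z Uz|]; first by apply: continuousD; [exact: cf|exact: cg].
- by [].
move=> i; have [dfi Cf] := df i; have [dgi Cg] := dg i.
split=> [z Uz|]; first by apply: derivableD; [exact: dfi|exact: dgi].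
apply: Ck_ext (IH _ _ Cf Cg) => // z Uz.
by rewrite deriveD //; [exact: dfi|exact: dgi].
Qed.

Lemma CkM k U f g : open U -> Ck k U f -> Ck k U g -> Ck k U (f * g).
Proof.
move=> oU; elim: k f g => [|k IH] f g /= Cf0 Cg0.
all: have [cf df] := Cf0; have [cg dg] := Cg0.
all: split=> [z Uz|]; first by apply: continuousM; [exact: cf|exact: cg].
- by [].
move=> i; have [dfi Cf] := df i; have [dgi Cg] := dg i.
split=> [z Uz|]; first by apply: derivableM; [exact: dfi|exact: dgi].
apply: Ck_ext (CkD oU (IH _ _ (CkW Cf0) Cg) (IH _ _ (CkW Cg0) Cf)) => // z Uz.
by rewrite deriveM //; [exact: dfi|exact: dgi].
Qed.

Lemma smooth_cst U c : smooth_on U (fun=> c).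
Proof. by move=> k; exact: Ck_cst. Qed.

Lemma smoothD U f g : open U -> smooth_on U f -> smooth_on U g ->
  smooth_on U (fun z => f z + g z).
Proof. by move=> oU sf sg k; exact: (CkD oU (sf k) (sg k)). Qed.

Lemma smoothM U f g : open U -> smooth_on U f -> smooth_on U g ->
  smooth_on U (fun z => f z * g z).
Proof. by move=> oU sf sg k; exact: (CkM oU (sf k) (sg k)). Qed.

Lemma smooth_derivable U f z v : smooth_on U f -> U z -> derivable f z v.
Proof. by move=> /(_ 1%N) /= [_ /(_ v) [dfv _]] Uz; exact: dfv. Qed.

End SmoothFunctions.

Section ExteriorAlgebra.
Context (A : comPzRingType) (V : lmodType A).
Implicit Types (w : seq V -> A) (u v : V) (f : A).

(* A sum of alternating forms of all degrees on V is a function w on lists of vectors; its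
   degree k part is its restriction to lists of length k. *)
Definition multilinear w := forall s f v u t,
  w (s ++ (f *: v + u) :: t) = f * w (s ++ v :: t) + w (s ++ u :: t).

Definition alternating w := forall s v t, w (s ++ v :: v :: t) = 0.

Definition alt_form w := multilinear w /\ alternating w.

Definition contr v w : seq V -> A := fun s => w (v :: s).
Definition grading w : seq V -> A := fun s => (-1) ^+ size s * w s.

(* The wedge product, normalized by (a /\ b)(u, v) = a(u) b(v) - a(v) b(u), defined by the
   rule that contraction with v is an antiderivation. *)
Fixpoint wedge_alt w1 w2 (s : seq V) : A :=
  match s with
  | [::] => w1 [::] * w2 [::]
  | v :: t => wedge_alt (contr v w1) w2 t + wedge_alt (grading w1) (contr v w2) t
  end.

Let comb f w w' : seq V -> A := fun s => f * w s + w' s.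

Let grading_comb f w w' : grading (comb f w w') = comb f (grading w) (grading w').
Proof. by apply/funext => s; rewrite /grading /comb; ring. Qed.

Let wedge_comb_l f w w' w2 s :
  wedge_alt (comb f w w') w2 s = f * wedge_alt w w2 s + wedge_alt w' w2 s.
Proof.
elim: s w w' w2 => [|v s IH] w w' w2 /=; first by rewrite /comb; ring.
by rewrite -/(comb f (contr v w) (contr v w')) grading_comb !IH; ring.
Qed.

Let wedge_comb_r f w w' w1 s :
  wedge_alt w1 (comb f w w') s = f * wedge_alt w1 w s + wedge_alt w1 w' s.
Proof.
elim: s w w' w1 => [|v s IH] w w' w1 /=; first by rewrite /comb; ring.
by rewrite -/(comb f (contr v w) (contr v w')) !IH; ring.
Qed.

Let combD w w' : w + w' = comb 1 w w'.
Proof. by apply/funext => s; rewrite /comb mul1r. Qed.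

Let comb0 : (0 : seq V -> A) = comb 0 0 0.
Proof. by apply/funext => s; rewrite /comb mul0r add0r. Qed.

Let combN w : - w = comb (-1) w 0.
Proof. by apply/funext => s; rewrite /comb mulN1r addr0. Qed.

Lemma wedge_alt0l w s : wedge_alt 0 w s = 0.
Proof.
have := wedge_comb_l 1 0 0 w s; rewrite -combD addr0 mul1r => H.
by apply: (addrI (wedge_alt 0 w s)); rewrite addr0 -H.
Qed.

Lemma wedge_alt0r w s : wedge_alt w 0 s = 0.
Proof.
have := wedge_comb_r 1 0 0 w s; rewrite -combD addr0 mul1r => H.
by apply: (addrI (wedge_alt w 0 s)); rewrite addr0 -H.
Qed.

Lemma wedge_altDl w w' w2 s :
  wedge_alt (w + w') w2 s = wedge_alt w w2 s + wedge_alt w' w2 s.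
Proof. by rewrite combD wedge_comb_l mul1r. Qed.

Lemma wedge_altDr w w' w1 s :
  wedge_alt w1 (w + w') s = wedge_alt w1 w s + wedge_alt w1 w' s.
Proof. by rewrite combD wedge_comb_r mul1r. Qed.

Lemma wedge_altNl w w2 s : wedge_alt (- w) w2 s = - wedge_alt w w2 s.
Proof. by rewrite combN wedge_comb_l wedge_alt0l mulN1r addr0. Qed.

Lemma wedge_altNr w w2 s : wedge_alt w2 (- w) s = - wedge_alt w2 w s.
Proof. by rewrite combN wedge_comb_r wedge_alt0r mulN1r addr0. Qed.

Lemma contr_grading w v : contr v (grading w) = - grading (contr v w).
Proof.
apply/funext => s; rewrite /contr /grading /=.
by rewrite exprS mulN1r mulNr.
Qed.

Lemma gradingK w : grading (grading w) = w.
Proof. by apply/funext => s; rewrite /grading mulrA -expr2 sqrr_sign mul1r. Qed.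

Lemma alt_form_contr w v : alt_form w -> alt_form (contr v w).
Proof.
by move=> [wl wa]; split=> [s|s]; [exact: (wl (v :: s))|exact: (wa (v :: s))].
Qed.

Lemma alt_form_grading w : alt_form w -> alt_form (grading w).
Proof.
move=> [wl wa]; split=> [s f v u t|s v t].
  by rewrite /grading !size_cat /= wl; ring.
by rewrite /grading wa mulr0.
Qed.

Let contr_lin w f v u : alt_form w ->
  contr (f *: v + u) w = comb f (contr v w) (contr u w).
Proof. by move=> [wl _]; apply/funext => s; exact: (wl [::]). Qed.

Let contr2 w v : alt_form w -> contr v (contr v w) = 0.
Proof. by move=> [_ wa]; apply/funext => s; exact: (wa [::]). Qed.

Lemma alt_form_wedge w1 w2 : alt_form w1 -> alt_form w2 -> alt_form (wedge_alt w1 w2).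
Proof.
move=> F1 F2; split.
  move=> s f v u t; elim: s w1 w2 F1 F2 => [|x s IH] w1 w2 F1 F2 /=.
    by rewrite !contr_lin // wedge_comb_l wedge_comb_r; ring.
  rewrite !IH //; try exact: alt_form_contr; try exact: alt_form_grading.
  by ring.
move=> s v t; elim: s w1 w2 F1 F2 => [|x s IH] w1 w2 F1 F2 /=.
  rewrite !contr2 // contr_grading wedge_alt0l wedge_alt0r wedge_altNl.
  by rewrite add0r addr0 subrr.
rewrite !IH ?addr0 //; try exact: alt_form_contr; exact: alt_form_grading.
Qed.

End ExteriorAlgebra.

(* A point of C^n, or a tangent vector, is a row vector (x_1, ..., x_n, y_1, ..., y_n)
   with z_j = x_j + i y_j; multJ is multiplication by i. *)
Section LocalForms.
Context (R : realType) (n : nat).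
Local Notation E := 'rV[R]_(n + n).
Implicit Types (phi : E -> seq E -> R) (z v : E) (s t : seq E).

Definition multJ (v : E) : E := row_mx (- rsubmx v) (lsubmx v).

Definition holomorphic_on (U : set E) (F : E -> E) :=
  (forall i, smooth_on U (fun z => F z 0 i)) /\
  (forall z v, U z -> 'd F z (multJ v) = multJ ('d F z v)).

Lemma derive_lin (a : R) (f g : E -> R) z v :
  derivable f z v -> derivable g z v ->
  derivable (fun y => a * f y + g y) z v /\
  'D_v (fun y => a * f y + g y) z = a * 'D_v f z + 'D_v g z.
Proof.
move=> df dg; have daf : derivable (a \*: f) z v by exact: derivableZ.
split; first exact: (derivableD daf dg).
have := deriveD daf dg; rewrite (deriveZ a df) => <-; by [].
Qed.

Lemma derive_mul (f g : E -> R) z v :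
  derivable f z v -> derivable g z v ->
  derivable (fun y => f y * g y) z v /\
  'D_v (fun y => f y * g y) z = 'D_v f z * g z + f z * 'D_v g z.
Proof.
move=> df dg; split; first exact: (derivableM df dg).
have := deriveM df dg; rewrite addrC [g z *: _]mulrC => <-; by [].
Qed.

(* d phi (v_0, ..., v_k) = sum_i (-1)^i D_(v_i) (phi (v_0, .., v_i omitted, .., v_k))
   for constant vector fields v_0, ..., v_k *)
Definition extd phi z s : R :=
  \sum_(i < size s) (-1) ^+ i *
    'D_(nth 0 s i) (fun y => phi y (take i s ++ drop i.+1 s)) z.

Lemma extd_cons phi z v t :
  extd phi z (v :: t) =
  'D_v (fun y => phi y t) z - extd (fun y => contr v (phi y)) z t.
Proof.
rewrite /extd /= big_ord_recl /= expr0 mul1r drop0; congr (_ + _).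
rewrite -sumrN; apply: eq_bigr => i _.
by rewrite /bump /= add1n exprS mulN1r mulNr.
Qed.

Definition derivable_at phi z := forall s v, derivable (fun y => phi y s) z v.

Lemma derivable_at_contr phi z v :
  derivable_at phi z -> derivable_at (fun y => contr v (phi y)) z.
Proof. by move=> d s u; exact: d. Qed.

Lemma derive_scale (a : R) (f : E -> R) z v : derivable f z v ->
  derivable (fun y => a * f y) z v /\ 'D_v (fun y => a * f y) z = a * 'D_v f z.
Proof.
by move=> df; split; [exact: (derivableZ (k := a) df)|exact: (deriveZ a df)].
Qed.

Lemma derivable_at_grading phi z :
  derivable_at phi z -> derivable_at (fun y => grading (phi y)) z.
Proof. by move=> d s u; exact: (derive_scale _ (d s u)).1. Qed.

Lemma extd_lin (a : R) phi psi z s : derivable_at phi z -> derivable_at psi z ->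
  extd (fun y => a *: phi y + psi y) z s = a * extd phi z s + extd psi z s.
Proof.
move=> dphi dpsi; rewrite /extd mulr_sumr -big_split /=; apply: eq_bigr => i _.
set t := _ ++ _; set v := nth _ _ _.
rewrite [X in _ * X](derive_lin a (dphi t v) (dpsi t v)).2.
by rewrite mulrDr mulrCA.
Qed.

Lemma extd_cst (w : seq E -> R) z s : extd (fun=> w) z s = 0.
Proof. by apply: big1 => i _; rewrite derive_cst mulr0. Qed.

Lemma extd_grading phi z s : derivable_at phi z ->
  extd (fun y => grading (phi y)) z s = - grading (extd phi z) s.
Proof.
elim: s phi => [|v t IH] phi dphi.
  by rewrite /extd /grading /= !big_ord0 mulr0 oppr0.
rewrite extd_cons.
have -> : (fun y => contr v (grading (phi y))) =
          (fun y => (-1) *: grading (contr v (phi y)) + 0).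
  by apply/funext => y; rewrite contr_grading scaleN1r addr0.
have dphi' := derivable_at_contr (v := v) dphi.
rewrite extd_lin; last 2 first.
- exact: derivable_at_grading.
- by move=> u w; exact: derivable_cst.
rewrite extd_cst addr0 IH // [X in X - _](derive_scale _ (dphi t v)).2.
by rewrite /grading /= extd_cons exprS; ring.
Qed.

Lemma wedge_derive phi psi z v s : derivable_at phi z -> derivable_at psi z ->
  derivable (fun y => wedge_alt (phi y) (psi y) s) z v /\
  'D_v (fun y => wedge_alt (phi y) (psi y) s) z =
  wedge_alt (fun t => 'D_v (phi ^~ t) z) (psi z) s +
  wedge_alt (phi z) (fun t => 'D_v (psi ^~ t) z) s.
Proof.
elim: s phi psi => [|u s IH] phi psi dphi dpsi /=.
  exact: derive_mul (dphi _ _) (dpsi _ _).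
have [d1 E1] := IH _ _ (derivable_at_contr (v := u) dphi) dpsi.
have [d2 E2] := IH _ _ (derivable_at_grading dphi) (derivable_at_contr (v := u) dpsi).
split; first exact: (derivableD d1 d2).
rewrite [LHS](deriveD d1 d2) E1 E2 addrACA.
congr (_ + _ + (_ + _)); congr (wedge_alt _ _ _).
by apply/funext => t; exact: (derive_scale _ (dphi t v)).2.
Qed.

Lemma extd_wedge phi psi z s : derivable_at phi z -> derivable_at psi z ->
  extd (fun y => wedge_alt (phi y) (psi y)) z s =
  wedge_alt (extd phi z) (psi z) s + wedge_alt (grading (phi z)) (extd psi z) s.
Proof.
elim: s phi psi => [|u s IH] phi psi dphi dpsi.
  by rewrite /extd /= !big_ord0 mul0r mulr0 addr0.
have dphi' := derivable_at_contr (v := u) dphi.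
have dpsi' := derivable_at_contr (v := u) dpsi.
have gphi := derivable_at_grading dphi.
rewrite extd_cons (wedge_derive _ _ dphi dpsi).2 /=.
have C chi : contr u (extd chi z) =
    (fun t => 'D_u (chi ^~ t) z) - extd (fun y => contr u (chi y)) z.
  by apply/funext => t; rewrite /contr extd_cons.
rewrite (_ : (fun y => contr u _) = (fun y =>
  1 *: wedge_alt (contr u (phi y)) (psi y) +
  wedge_alt (grading (phi y)) (contr u (psi y)))); last first.
  by apply/funext => y; rewrite scale1r.
rewrite extd_lin; last 2 first.
- by move=> t v; have [] := wedge_derive v t dphi' dpsi.
- by move=> t v; have [] := wedge_derive v t gphi dpsi'.
rewrite mul1r !IH // !C contr_grading gradingK.
rewrite !(wedge_altDl, wedge_altDr, wedge_altNl, wedge_altNr).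
rewrite (_ : extd (fun y => grading (phi y)) z = - grading (extd phi z)).
  by rewrite wedge_altNl; ring.
by apply/funext => t; rewrite extd_grading.
Qed.

End LocalForms.

Record chart (R : realType) (m : nat) (T : topologicalType) := Chart {
  dom : set T;
  coord : T -> 'rV[R]_m;
  icoord : 'rV[R]_m -> T;
  dom_open : open dom;
  coord_open : open (coord @` dom);
  coordK : forall x, dom x -> icoord (coord x) = x;
  coord_continuous : forall x, dom x -> {for x, continuous coord};
  icoord_continuous :
    forall z, (coord @` dom) z -> {for z, continuous icoord} }.

Arguments dom_open {R m T} c.
Arguments coord_open {R m T} c.

Definition cimage (R : realType) (m : nat) (T : topologicalType)
  (c : chart R m T) : set 'rV[R]_m := coord c @` dom c.

Definition transition (R : realType) (m : nat) (T : topologicalType)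
  (c c' : chart R m T) : 'rV[R]_m -> 'rV[R]_m := coord c' \o icoord c.

(* Second countability is not required: it is automatic for compact manifolds. *)
Record complexManifold (R : realType) (n : nat) := ComplexManifold {
  carrier :> topologicalType;
  carrier_hausdorff : hausdorff_space carrier;
  atlas : set (chart R (n + n) carrier);
  atlas_cover : forall x, exists2 c, atlas c & dom c x;
  atlas_holomorphic : forall c c', atlas c -> atlas c' ->
    holomorphic_on (coord c @` (dom c `&` dom c')) (transition c c') }.

Section Forms.
Context (R : realType) (n : nat) (X : complexManifold R n).
Local Notation E := 'rV[R]_(n + n).
Local Notation Chart := (chart R (n + n) X).
Local Notation preform := (Chart -> E -> seq E -> R).

(* w c z (v_1, ..., v_k) is the value at the point of coordinates z in the chart c,
   the v_i being tangent vectors in coordinates; lists of all lengths are allowed, so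
   that w is a sum of forms of all degrees.  The first clause sets junk values to 0. *)
Definition smooth_form (w : preform) : Prop :=
  [/\ forall c z s, ~ (atlas c /\ cimage c z) -> w c z s = 0,
      forall c z, alt_form (w c z),
      forall c s, atlas c -> smooth_on (cimage c) (fun z => w c z s) &
      forall c c' x s, atlas c -> atlas c' -> dom c x -> dom c' x ->
        w c (coord c x) s =
        w c' (coord c' x) (map ('d (transition c c') (coord c x)) s)].

Definition form_pred : {pred preform} := fun w => `[< smooth_form w >].

Lemma form_submod_closed : GRing.submod_closed form_pred.
Proof.
split.
  apply/asboolP; split=> // [c z|c s _].
    by split=> [s f v u t|//]; rewrite mulr0 addr0.
  exact: smooth_cst.
move=> a w w' /asboolP[w0 wa ws wc] /asboolP[w0' wa' ws' wc']; apply/asboolP.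
have H c z s : (a *: w + w') c z s = a * w c z s + w' c z s by [].
split=> [c z s h|c z|c s Ac|c c' x s Ac Ac' cx cx'].
- by rewrite H w0 // w0' // mulr0 addr0.
- have [l1 a1] := wa c z; have [l2 a2] := wa' c z.
  by split=> [s f v u t|s v t]; rewrite !H ?a1 ?a2 ?l1 ?l2; ring.
- apply: (smoothD (coord_open c)); last exact: ws'.
  by apply: (smoothM (coord_open c)); [exact: smooth_cst|exact: ws].
- by rewrite !H (wc c c') // (wc' c c').
Qed.

HB.instance Definition _ := GRing.isSubmodClosed.Build R preform
  form_pred form_submod_closed.

Record form := Form { formval :> preform; _ : formval \in form_pred }.

HB.instance Definition _ := [isSub for formval].
HB.instance Definition _ := [Choice of form by <:].
HB.instance Definition _ := [SubChoice_isSubZmodule of form by <:].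
HB.instance Definition _ := [SubZmodule_isSubLmodule of form by <:].

Lemma formP (w : form) : smooth_form w.
Proof. by have /asboolP := valP w. Qed.

Lemma form_derivable (w : form) c z : atlas c -> cimage c z ->
  derivable_at (w c) z.
Proof.
move=> Ac cz s v; have [_ _ ws _] := formP w.
exact: smooth_derivable (ws c s Ac) cz.
Qed.

Arguments form_derivable w [c z].

Lemma alt_form0 : alt_form (0 : seq E -> R).
Proof. by split=> [s f v u t|//]; rewrite mulr0 addr0. Qed.

Lemma smooth_wedge (c : Chart) (w1 w2 : E -> seq E -> R) s :
  (forall t, smooth_on (cimage c) (w1 ^~ t)) ->
  (forall t, smooth_on (cimage c) (w2 ^~ t)) ->
  smooth_on (cimage c) (fun z => wedge_alt (w1 z) (w2 z) s).
Proof.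
elim: s w1 w2 => [|v s IH] w1 w2 s1 s2 /=.
  exact: (smoothM (coord_open c)).
apply: (smoothD (coord_open c)).
  by apply: (IH (fun z => contr v (w1 z))) => // t; exact: s1.
apply: (IH (fun z => grading (w1 z)) (fun z => contr v (w2 z))) => t; last exact: s2.
by apply: (smoothM (coord_open c)); [exact: smooth_cst|exact: s1].
Qed.

Lemma wedge_map (h : E -> E) (p1 p2 q1 q2 : seq E -> R) s :
  (forall t, p1 t = q1 (map h t)) -> (forall t, p2 t = q2 (map h t)) ->
  wedge_alt p1 p2 s = wedge_alt q1 q2 (map h s).
Proof.
elim: s p1 p2 q1 q2 => [|v s IH] p1 p2 q1 q2 e1 e2 /=; first by rewrite e1 e2.
congr (_ + _); apply: IH => // t; rewrite /contr ?e1 ?e2 //.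
by rewrite /grading size_map e1.
Qed.

Lemma wedge_subproof (w1 w2 : form) :
  (fun c z => wedge_alt (w1 c z) (w2 c z)) \in form_pred.
Proof.
have [z1 a1 s1 c1] := formP w1; have [z2 a2 s2 c2] := formP w2.
apply/asboolP; split=> [c z s h|c z|c s Ac|c c' x s Ac Ac' cx cx'].
- have -> : w1 c z = 0 by apply/funext => t; rewrite z1.
  exact: wedge_alt0l.
- exact: alt_form_wedge.
- by apply: (@smooth_wedge c (w1 c) (w2 c)) => t; [exact: s1|exact: s2].
- by apply: wedge_map => t; [exact: c1|exact: c2].
Qed.

Definition wedge (w1 w2 : form) : form := Form (wedge_subproof w1 w2).

Lemma grade_subproof (w : form) :
  (fun c z => grading (w c z)) \in form_pred.
Proof.
have [z0 a0 s0 c0] := formP w.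
apply/asboolP; split=> [c z s h|c z|c s Ac|c c' x s Ac Ac' cx cx'].
- by rewrite /grading z0 // mulr0.
- exact: alt_form_grading.
- by apply: (smoothM (coord_open c)); [exact: smooth_cst|exact: s0].
- by rewrite /grading (c0 c c') // size_map.
Qed.

Definition grade (w : form) : form := Form (grade_subproof w).

Definition is_extd (w theta : form) : Prop := forall c z s,
  atlas c -> cimage c z -> extd (w c) z s = theta c z s.

Lemma is_extd_lin (a : R) (w w' t t' : form) : is_extd w t -> is_extd w' t' ->
  is_extd (a *: w + w') (a *: t + t').
Proof.
move=> e e' c z s Ac cz; have d := form_derivable w Ac cz.
by rewrite (extd_lin a s d (form_derivable w' Ac cz)) e // e'.
Qed.

Lemma is_extd0 : is_extd 0 0.
Proof. by move=> c z s _ _; exact: extd_cst. Qed.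

Lemma is_extd_grade (w t : form) : is_extd w t -> is_extd (grade w) (- grade t).
Proof.
move=> e c z s Ac cz; rewrite (extd_grading s (form_derivable w Ac cz)).
by rewrite /grading e.
Qed.

Lemma is_extd_wedge (w w' t t' : form) : is_extd w t -> is_extd w' t' ->
  is_extd (wedge w w') (wedge t w' + wedge (grade w) t').
Proof.
move=> e e' c z s Ac cz; have d := form_derivable w Ac cz.
rewrite (extd_wedge s d (form_derivable w' Ac cz)).
have -> : extd (w c) z = t c z by apply/funext => u; exact: e.
have -> : extd (w' c) z = t' c z by apply/funext => u; exact: e'.
by [].
Qed.

Definition closed_pred : {pred form} := fun w => `[< is_extd w 0 >].

Lemma closed_submod_closed : GRing.submod_closed closed_pred.
Proof.
split; first by apply/asboolP; exact: is_extd0.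
move=> a w w' /asboolP e /asboolP e'; apply/asboolP.
by have := is_extd_lin a e e'; rewrite scaler0 addr0.
Qed.

HB.instance Definition _ := GRing.isSubmodClosed.Build R form
  closed_pred closed_submod_closed.

Record closedForm := ClosedForm { cformval :> form; _ : cformval \in closed_pred }.

HB.instance Definition _ := [isSub for cformval].
HB.instance Definition _ := [Choice of closedForm by <:].
HB.instance Definition _ := [SubChoice_isSubZmodule of closedForm by <:].
HB.instance Definition _ := [SubZmodule_isSubLmodule of closedForm by <:].

Lemma closedFormP (w : closedForm) : is_extd w 0.
Proof. by have /asboolP := valP w. Qed.

Definition exact_pred : {pred closedForm} :=
  fun w => `[< exists eta : form, is_extd eta w >].

Lemma exact_submod_closed : GRing.submod_closed exact_pred.
Proof.
split; first by apply/asboolP; exists 0; exact: is_extd0.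
move=> a w w' /asboolP[eta e] /asboolP[eta' e']; apply/asboolP.
by exists (a *: eta + eta'); exact: is_extd_lin.
Qed.

HB.instance Definition _ := GRing.isSubmodClosed.Build R closedForm
  exact_pred exact_submod_closed.

(* Forms are not assumed homogeneous: deRham is the direct sum of all H^k(X,R). *)
Definition deRham := Quotient.quot (exact_pred : zmodClosed closedForm).

HB.instance Definition _ := GRing.Zmodule.on deRham.

Definition cls (w : closedForm) : deRham := \pi w.

Lemma clsP w w' : cls w = cls w' <-> exists eta : form, is_extd eta (val (w - w')).
Proof.
split=> [/eqP|e]; first by rewrite -Quotient.idealrBE => /asboolP.
by apply/eqP; rewrite -Quotient.idealrBE; apply/asboolP.
Qed.

Lemma clsK (a : deRham) : cls (repr a) = a.
Proof. exact: reprK. Qed.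

Definition deRham_scale (r : R) (a : deRham) : deRham := cls (r *: repr a).

Lemma clsZ r w : cls (r *: w) = deRham_scale r (cls w).
Proof.
apply/clsP; have /clsP[eta e] := esym (clsK (cls w)).
exists (r *: eta); rewrite -scalerBr.
by have := is_extd_lin r e is_extd0; rewrite !addr0.
Qed.

Lemma clsD w w' : cls (w + w') = cls w + cls w'.
Proof. by rewrite /cls piE. Qed.

Let scaleA r s a : deRham_scale r (deRham_scale s a) = deRham_scale (r * s) a.
Proof. by rewrite -(clsK a) -!clsZ scalerA. Qed.

Let scale1 : left_id 1 deRham_scale.
Proof. by move=> a; rewrite -(clsK a) -clsZ scale1r. Qed.

Let scaleDr : right_distributive deRham_scale +%R.
Proof.
by move=> r a b; rewrite -(clsK a) -(clsK b) -!(clsZ, clsD) scalerDr.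
Qed.

Let scaleDl a : {morph deRham_scale^~ a : r s / r + s}.
Proof. by move=> r s; rewrite -(clsK a) -!(clsZ, clsD) scalerDl. Qed.

HB.instance Definition _ := GRing.Zmodule_isLmodule.Build R deRham
  scaleA scale1 scaleDr scaleDl.

Lemma wedge_closed (w w' : closedForm) : wedge w w' \in closed_pred.
Proof.
apply/asboolP; have := is_extd_wedge (closedFormP w) (closedFormP w').
rewrite (_ : _ + _ = 0) //; apply/val_inj/funext => c; apply/funext => z.
by apply/funext => s; rewrite /= -[LHS]/(wedge_alt 0 _ s + wedge_alt _ 0 s)
  wedge_alt0l wedge_alt0r addr0.
Qed.

Definition cwedge (w w' : closedForm) : closedForm := ClosedForm (wedge_closed w w').

Definition cup (a b : deRham) : deRham := cls (cwedge (repr a) (repr b)).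

Lemma cupE w w' : cup (cls w) (cls w') = cls (cwedge w w').
Proof.
rewrite /cup; set v := repr (cls w); set v' := repr (cls w').
have /clsP[eta e] : cls v = cls w by exact: clsK.
have /clsP[eta' e'] : cls v' = cls w' by exact: clsK.
apply/clsP; exists (wedge eta v' + wedge (grade w) eta').
have e1 := is_extd_wedge e (closedFormP v').
have e2 := is_extd_wedge (is_extd_grade (closedFormP w)) e'.
have := is_extd_lin 1 e1 e2; rewrite !scale1r; congr is_extd.
apply/val_inj/funext => c; apply/funext => z; apply/funext => s /=.
pose W := v c z; pose W' := v' c z; pose U := w c z; pose U' := w' c z.
transitivity ((wedge_alt (W - U) W' s + wedge_alt (grading (eta c z)) 0 s) +
  (wedge_alt (- grading 0) (eta' c z) s +
   wedge_alt (grading (grading U)) (W' - U') s)); first by [].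
have -> : grading 0 = 0 :> (seq E -> R).
  by apply/funext => t; rewrite /grading mulr0.
rewrite oppr0 wedge_alt0l wedge_alt0r addr0 add0r gradingK.
rewrite !(wedge_altDl, wedge_altDr, wedge_altNl, wedge_altNr).
transitivity (wedge_alt W W' s - wedge_alt U U' s); last by [].
by ring.
Qed.

End Forms.

Section KahlerGeometry.
Context (R : realType) (n : nat) (X : complexManifold R n).
Local Notation E := 'rV[R]_(n + n).
Local Notation H := (deRham X).

(* C-multilinear extension of phi; the pair (u, v) stands for the complex tangent
   vector u + i v *)
Fixpoint cplx_ext (phi : seq E -> R) (s : seq (E * E)) : R[i] :=
  match s with
  | [::] => (phi [::])%:C%C
  | Z :: t => cplx_ext (contr Z.1 phi) t + 'i%C * cplx_ext (contr Z.2 phi) t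
  end.

(* tangent vectors v - iJv of type (1,0) and v + iJv of type (0,1) *)
Definition vec10 (v : E) : E * E := (v, - multJ v).
Definition vec01 (v : E) : E * E := (v, multJ v).

Definition type_pp (p : nat) (w : form X) : Prop := forall c z (s t : seq E),
  (size s, size t) <> (p, p) ->
  cplx_ext (w c z) (map vec10 s ++ map vec01 t) = 0.

(* H^{p,p}(X,R): the real classes that contain a closed real form of type (p,p) *)
Definition Hpp (p : nat) : set H :=
  [set a | exists2 w : closedForm X, type_pp p w & a = cls w].

Definition kahler_form (w : closedForm X) : Prop :=
  type_pp 1 w /\
  forall c z v, atlas c -> cimage c z -> v <> 0 -> 0 < w c z [:: v; multJ v].

Definition kahler_class : set H :=
  [set a | exists2 w : closedForm X, kahler_form w & a = cls w].

Definition compact_kahler : Prop :=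
  compact [set: X] /\ exists w : closedForm X, kahler_form w.

Fixpoint iterated_integral (m : nat) : ('rV[R]_m -> R) -> R :=
  match m with
  | 0 => fun F => F 0
  | m'.+1 => fun F => \int[lebesgue_measure]_t
      iterated_integral (fun z : 'rV[R]_m' => F (row_mx (const_mx t : 'rV[R]_1) z))
  end.

(* d/dx_1, d/dy_1, ..., d/dx_n, d/dy_n, in the order of the complex orientation *)
Definition oriented_frame : seq E :=
  flatten [seq [:: delta_mx 0 (lshift n j); delta_mx 0 (rshift n j)] | j <- enum 'I_n].

Definition homogeneous (k : nat) (w : form X) : Prop :=
  forall c z s, size s <> k -> w c z s = 0.

Definition supported_in (K : set X) (w : form X) : Prop :=
  forall c z s, atlas c -> cimage c z -> ~ K (icoord c z) -> w c z s = 0.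

(* The integral over X is the only linear map on cohomology with these properties:
   it exists by Stokes' theorem, and is unique by partitions of unity. *)
Definition is_integration (I : {linear H -> R^o}) : Prop :=
  (forall k (w : closedForm X), homogeneous k w -> k <> (n + n)%N ->
     I (cls w) = 0) /\
  (forall c K (w : closedForm X), atlas c -> compact K -> K `<=` dom c ->
     homogeneous (n + n) w -> supported_in K w ->
     I (cls w) = iterated_integral (fun z => w c z oriented_frame)).

Definition integral : {linear H -> R^o} :=
  match pselect (exists I, is_integration I) with
  | left h => projT1 (cid h)
  | right _ => \0
  end.

(* a^k . b *)
Definition cup_exp (a : H) (k : nat) (b : H) : H := iter k (cup a) b.

(* a_1 . ... . a_d . b *)
Definition cup_seq (s : seq H) (b : H) : H := foldr (@cup R n X) b s.

Definition lin_comb (N : nat) (e : 'I_N -> H) (b : 'rV[R]_N) : H :=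
  \sum_i b 0 i *: e i.

Definition basis_of (S : set H) (N : nat) (e : 'I_N -> H) : Prop :=
  (forall i, S (e i)) /\ (forall a, S a -> exists! b, a = lin_comb e b).

(* the closure is taken in H^{1,1}(X,R), identified with R^N by means of a basis *)
Definition nef : set H := [set a | exists (N : nat) (e : 'I_N -> H) (b : 'rV[R]_N),
  [/\ basis_of (Hpp 1) e, a = lin_comb e b &
      closure [set b' | kahler_class (lin_comb e b')] b]].

(* B has signature (+, -, ..., -) on H^{1,1}(X,R) *)
Definition lorentzian_signature (B : H -> H -> R) : Prop :=
  exists (N : nat) (e : 'I_N.+1 -> H),
    [/\ basis_of (Hpp 1) e,
        (forall i j, i != j -> B (e i) (e j) = 0),
        0 < B (e ord0) (e ord0) &
        (forall i, i != ord0 -> B (e i) (e i) < 0)].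

Definition strictly_lorentzian (d : nat) (Omega : H) : Prop :=
  [/\ (2 <= d <= n)%N, Hpp (n - d) Omega,
      (forall s : d.-tuple H, (forall a, a \in s -> kahler_class a) ->
         0 < integral (cup_seq s Omega)) &
      (forall s : (d - 2).-tuple H, (forall a, a \in s -> kahler_class a) ->
         lorentzian_signature
           (fun xi eta => integral (cup xi (cup eta (cup_seq s Omega)))))].

Definition big_on (d : nat) (Omega a : H) : Prop := 0 < integral (cup_exp a d Omega).

End KahlerGeometry.

(* Main.v *)
(* Write [P] for the multilinear form (a_1, ..., a_d) |-> a_1 ... a_d . Omega on H^{1,1}.  The
   Hodge inequality P(x,x,s) P(y,y,s) <= P(x,y,s)^2 and the resulting lower bounds on mixed
   numbers pass from Kahler to nef classes.  If alpha^k . Omega = beta^k . Omega, the positive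
   log-concave sequence a_i = alpha^i . beta^(d-i) . Omega satisfies a_(k+j) = a_j, hence is
   constant.  So v = alpha - beta is isotropic and orthogonal to alpha for every form
   P(., ., s), s a word of length d - 2 in alpha and beta; equality in the Hodge inequality
   puts v in the kernel of these forms.  This persists when the letters of s are replaced one
   by one by a Kahler class om: P(v, v, om, s) and P(alpha, v, om, s) vanish because v was in
   the kernel for the words alpha :: s and beta :: s.  At the end v is in the kernel of
   P(., ., om, ..., om), which is nondegenerate. *)
Require Import Defs.
From HB Require Import structures.
From mathcomp Require Import all_boot all_order all_algebra.
From mathcomp Require Import all_classical all_reals all_analysis.
From mathcomp Require Import complex ring lra zify.
Set Implicit Arguments.
Unset Strict Implicit.
Unset Printing Implicit Defensive.
Import Order.TTheory GRing.Theory Num.Theory.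
Import numFieldNormedType.Exports.
Local Open Scope classical_set_scope.
Local Open Scope ring_scope.

(** * Associativity and graded commutativity of the wedge product *)

Section WedgeAlgebra.
Context (A : comPzRingType) (V : lmodType A).
Implicit Types (w : seq V -> A) (v : V) (s : seq V).

Lemma grading_wedge w1 w2 :
  grading (wedge_alt w1 w2) = wedge_alt (grading w1) (grading w2).
Proof.
apply/funext => s; elim: s w1 w2 => [|v s IH] w1 w2.
  by rewrite /grading /= !mul1r.
rewrite {1}/grading /= !contr_grading wedge_altNl wedge_altNr -!IH.
by rewrite /grading exprS; ring.
Qed.

(** Contraction with a vector is an antiderivation on both sides and yields the same three terms;
    they match by induction because [grading] is multiplicative. *)
Lemma wedge_altA w1 w2 w3 :
  wedge_alt w1 (wedge_alt w2 w3) = wedge_alt (wedge_alt w1 w2) w3.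
Proof.
apply/funext => s; elim: s w1 w2 w3 => [|v s IH] w1 w2 w3 /=.
  by rewrite mulrA.
have contr_wedge a b : contr v (wedge_alt a b) =
    wedge_alt (contr v a) b + wedge_alt (grading a) (contr v b) by [].
by rewrite !contr_wedge wedge_altDl wedge_altDr !IH grading_wedge addrA.
Qed.

(* Swapping with an odd form costs the sign (-1)^deg; the even and odd cases are proved
   together because contraction exchanges them. *)
Lemma wedge_altC_parity s w1 w2 :
  (grading w1 = w1 -> wedge_alt w1 w2 s = wedge_alt w2 w1 s) /\
  (grading w1 = - w1 -> wedge_alt w1 w2 s = wedge_alt (grading w2) w1 s).
Proof.
elim: s w1 w2 => [|v s IH] w1 w2 /=.
  by split=> _; rewrite /grading /= ?mul1r mulrC.
have contr_odd : grading w1 = w1 -> grading (contr v w1) = - contr v w1.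
  move=> g; apply/funext => t; have := congr1 (contr v ^~ t) g.
  by rewrite contr_grading => /(congr1 -%R); rewrite /= opprK.
have contr_even : grading w1 = - w1 -> grading (contr v w1) = contr v w1.
  move=> g; apply/funext => t; have := congr1 (@^~ t) (contr_grading w1 v).
  by rewrite g => /oppr_inj; exact: esym.
split=> g; rewrite g.
- by rewrite (IH _ w2).2 ?contr_odd // (IH w1 _).1 // addrC.
- rewrite (IH _ w2).1 ?contr_even // wedge_altNl (IH w1 _).2 //.
  by rewrite contr_grading wedge_altNl gradingK addrC.
Qed.

Lemma wedge_altC w1 w2 : grading w1 = w1 -> wedge_alt w1 w2 = wedge_alt w2 w1.
Proof. by move=> g; apply/funext => s; exact: (wedge_altC_parity s w1 w2).1. Qed.

Lemma wedge_altZl (f : A) w1 w2 s :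
  wedge_alt (fun t => f * w1 t) w2 s = f * wedge_alt w1 w2 s.
Proof.
elim: s w1 w2 => [|v s IH] w1 w2 /=; first by rewrite mulrA.
have -> : grading (fun t => f * w1 t) = (fun t => f * grading w1 t).
  by apply/funext => t; rewrite /grading mulrCA.
by rewrite mulrDr -!IH.
Qed.

Lemma wedge_altZr (f : A) w1 w2 s :
  wedge_alt w1 (fun t => f * w2 t) s = f * wedge_alt w1 w2 s.
Proof.
elim: s w1 w2 => [|v s IH] w1 w2 /=; first by rewrite mulrCA.
by rewrite mulrDr -!IH.
Qed.

End WedgeAlgebra.

(** * Complex multilinear extension and vectors of type (1,0) and (0,1) *)

Section ComplexExtension.
Context (R : realType) (n : nat).
Local Notation E := 'rV[R]_(n + n).
Implicit Types (phi psi : seq E -> R) (s t : seq (E * E)).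

Lemma cplx_ext_lin (a : R) phi psi s :
  cplx_ext (fun x => a * phi x + psi x) s =
  a%:C%C * cplx_ext phi s + cplx_ext psi s.
Proof.
elim: s phi psi => [|Z s IH] phi psi /=; first by rewrite rmorphD rmorphM.
have H u : contr u (fun x => a * phi x + psi x) =
  (fun x => a * contr u phi x + contr u psi x) by [].
by rewrite !H !IH; ring.
Qed.

Lemma cplx_ext0 s : cplx_ext (0 : seq E -> R) s = 0.
Proof.
elim: s => [//|Z s IH] /=.
have H u : contr u (0 : seq E -> R) = 0 by [].
by rewrite !H IH mulr0 addr0.
Qed.

Lemma cplx_extN phi s : cplx_ext (- phi) s = - cplx_ext phi s.
Proof.
have -> : - phi = (fun x => -1 * phi x + (0 : seq E -> R) x).
  by apply/funext => x; rewrite mulN1r addr0.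
by rewrite cplx_ext_lin cplx_ext0 addr0 rmorphN rmorph1 mulN1r.
Qed.

Lemma contrN phi u : alt_form phi -> contr (- u) phi = - contr u phi.
Proof.
move=> [l _]; have z : contr 0 phi = 0.
  apply/funext => s; have := l [::] 1 0 0 s.
  rewrite scaler0 addr0 mul1r /= => H.
  by apply: (addrI (phi (0 :: s))); rewrite addr0 -H.
apply/funext => s; have := l [::] (-1) u 0 s.
rewrite scaleN1r addr0 mulN1r /= -[phi (0 :: s)]/(contr 0 phi s) z addr0.
exact.
Qed.

(** Polarization: expand the value on two equal vectors v + u, which is zero. *)
Lemma contr_anticomm phi u v : alt_form phi ->
  contr u (contr v phi) = - contr v (contr u phi).
Proof.
move=> [l a]; apply/funext => s; apply/eqP; rewrite -addr_eq0; apply/eqP.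
have := l [::] 1 v u (v + u :: s); rewrite scale1r mul1r /= (a [::]).
have := l [:: v] 1 v u s; rewrite scale1r mul1r /= (a [::]) add0r => ->.
have := l [:: u] 1 v u s; rewrite scale1r mul1r /= (a [::] u) addr0 => ->.
by rewrite addrC => ->.
Qed.

Lemma cplx_ext_swap phi s t Z W : alt_form phi ->
  cplx_ext phi (s ++ Z :: W :: t) = - cplx_ext phi (s ++ W :: Z :: t).
Proof.
elim: s phi => [|Y s IH] phi aphi /=; last first.
  by rewrite !IH; try exact: alt_form_contr; rewrite opprD mulrN.
rewrite (contr_anticomm Z.1 W.1) // (contr_anticomm Z.1 W.2) //.
rewrite (contr_anticomm Z.2 W.1) // (contr_anticomm Z.2 W.2) // !cplx_extN.
by ring.
Qed.

Lemma cplx_ext_move phi s t Z : alt_form phi ->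
  cplx_ext phi (Z :: s ++ t) = (-1) ^+ size s * cplx_ext phi (s ++ Z :: t).
Proof.
elim: s phi Z => [|W s IH] phi Z aphi; first by rewrite mul1r.
rewrite [LHS](cplx_ext_swap [::]) // [size _]/= exprS mulN1r mulNr; congr (- _).
have IHc u := IH (contr u phi) Z (alt_form_contr u aphi).
by rewrite /= in IHc *; rewrite !IHc; ring.
Qed.

(** A real vector v is half the sum of [vec10 v] and [vec01 v]. The induction peels off one v: after
    [vec01 v] is moved to the front, adding the two vanishing values cancels the [multJ v] terms and
    leaves twice the extension of [contr v phi]. *)
Lemma vanish_of_cplx_ext m phi : alt_form phi ->
  (forall s t : seq E, (size s + size t)%N = m ->
     cplx_ext phi (map (@vec10 R n) s ++ map (@vec01 R n) t) = 0) ->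
  forall u, size u = m -> phi u = 0.
Proof.
elim: m phi => [|m IH] phi aphi v0 [|v u] //=.
  by move=> _; have /= := v0 [::] [::] erefl => -[].
move=> [su]; apply: (IH (contr v phi)) => //; first exact: alt_form_contr.
move=> s t st.
have h1 := v0 (v :: s) t; have h2 := v0 s (v :: t).
rewrite /= addSn addnS st in h1 h2.
have {}h1 := h1 erefl; have {}h2 := h2 erefl.
have := cplx_ext_move (map (@vec10 R n) s) (map (@vec01 R n) t) (vec01 v) aphi.
rewrite h2 mulr0 /= => h3.
rewrite contrN // cplx_extN in h1.
have : 2 * cplx_ext (contr v phi) (map (@vec10 R n) s ++ map (@vec01 R n) t) = 0.
  rewrite mulr_natl mulr2n -[RHS](addr0 0) -{1}h1 -h3; ring.
by move/eqP; rewrite mulf_eq0 pnatr_eq0 /= => /eqP.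
Qed.

End ComplexExtension.

(** * The cup product: bilinearity, associativity, commutation with (1,1)-classes *)

Section CupAlgebra.
Context (R : realType) (n : nat) (X : complexManifold R n).
Local Notation H := (deRham X).
Implicit Types (a b c : H).

Lemma closed_form_eq (w w' : closedForm X) :
  (forall x z s, w x z s = w' x z s) -> w = w'.
Proof.
move=> e; apply/val_inj/val_inj/funext => x; apply/funext => z.
by apply/funext => s; exact: e.
Qed.

Lemma cup_linl (r : R) a b c : cup (r *: a + b) c = r *: cup a c + cup b c.
Proof.
rewrite -(clsK a) -(clsK b) -(clsK c).
rewrite -[r *: _]/(deRham_scale r _) -clsZ -clsD !cupE.
rewrite -[r *: _]/(deRham_scale r _) -clsZ -clsD; congr cls.
apply: closed_form_eq => x z s /=.
set u := repr a; set v := repr b; set w := repr c.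
rewrite -[LHS]/(wedge_alt ((fun t => r * u x z t) + v x z) (w x z) s).
by rewrite wedge_altDl wedge_altZl.
Qed.

Lemma cup_linr (r : R) a b c : cup c (r *: a + b) = r *: cup c a + cup c b.
Proof.
rewrite -(clsK a) -(clsK b) -(clsK c).
rewrite -[r *: _]/(deRham_scale r _) -clsZ -clsD !cupE.
rewrite -[r *: _]/(deRham_scale r _) -clsZ -clsD; congr cls.
apply: closed_form_eq => x z s /=.
set u := repr a; set v := repr b; set w := repr c.
rewrite -[LHS]/(wedge_alt (w x z) ((fun t => r * u x z t) + v x z) s).
by rewrite wedge_altDr wedge_altZr.
Qed.

Lemma cupA a b c : cup a (cup b c) = cup (cup a b) c.
Proof.
rewrite -(clsK a) -(clsK b) -(clsK c) !cupE; congr cls.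
by apply: closed_form_eq => x z s /=; rewrite wedge_altA.
Qed.

(** In every total degree other than 2 the complex extension of w vanishes, hence so does w; only an
    even degree survives. *)
Lemma type11_even (w : closedForm X) : type_pp 1 w ->
  forall x z, grading (w x z) = w x z.
Proof.
move=> w11 x z; apply/funext => s; rewrite /grading.
have [s2|s2] := eqVneq (size s) 2; first by rewrite s2 -signr_odd mul1r.
have [_ aw _ _] := formP w.
rewrite (vanish_of_cplx_ext (aw x z) _ (erefl (size s))) ?mulr0 // => u v uv.
by apply: w11 => -[us vs]; rewrite us vs in uv; rewrite -uv in s2.
Qed.

(** The class [a] has an even representative, which commutes with every form; so [b] may be
    arbitrary, in particular a product ending in [Omega]. *)
Lemma cupC a b : Hpp 1 a -> cup a b = cup b a.
Proof.
move=> [w w11 ->]; rewrite -(clsK b) !cupE; congr cls.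
apply: closed_form_eq => x z s /=; rewrite (wedge_altC _ (type11_even w11 x z)).
by [].
Qed.

Lemma cup_leftC a b c : Hpp 1 a -> cup a (cup b c) = cup b (cup a c).
Proof. by move=> a11; rewrite !cupA (cupC b a11). Qed.

Lemma type_pp_lin p (r : R) (w w' : closedForm X) : type_pp p w -> type_pp p w' ->
  type_pp p (r *: w + w').
Proof.
move=> wp wp' x z s t st.
have -> : (r *: w + w') x z = (fun u => r * w x z u + w' x z u) by [].
by rewrite cplx_ext_lin wp // wp' // mulr0 addr0.
Qed.

Lemma Hpp_lin p (r : R) a b : Hpp p a -> Hpp p b -> Hpp p (r *: a + b).
Proof.
move=> [w wp ->] [w' wp' ->]; exists (r *: w + w'); first exact: type_pp_lin.
by rewrite clsD clsZ.
Qed.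

Lemma Hpp0 p : Hpp p (0 : H).
Proof.
exists 0; last by rewrite -[RHS]addr0; apply/esym/(addrI (cls 0)); rewrite addr0 -clsD addr0.
by move=> x z s t _; exact: cplx_ext0.
Qed.

Lemma cup_seq_cat (s t : seq H) a : cup_seq (s ++ t) a = cup_seq s (cup_seq t a).
Proof. exact: foldr_cat. Qed.

Lemma cup_exp_nseq k a b : cup_exp a k b = cup_seq (nseq k a) b.
Proof. by elim: k => //= k ->. Qed.

(** The head of s is pulled out of its place in t past the letters of [t1]; the last factor [c]
    never moves and needs no type. *)
Lemma cup_seq_perm (s t : seq H) c : (forall a, a \in s -> Hpp 1 a) ->
  perm_eq s t -> cup_seq s c = cup_seq t c.
Proof.
elim: s t => [|a s IH] t Hs st; first by rewrite perm_sym in st; rewrite (perm_nilP st).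
have at_ : a \in t by rewrite -(perm_mem st) mem_head.
have Ha : Hpp 1 a by apply: Hs; rewrite mem_head.
have [t1 [t2 tE]] : exists t1 t2, t = t1 ++ a :: t2.
  by case/splitPr: at_ => t1 t2; exists t1, t2.
have st' : perm_eq s (t1 ++ t2).
  rewrite -(perm_cons a) (perm_trans st) // tE.
  exact: permEl (perm_catCA t1 [:: a] t2).
rewrite /= (IH _ _ st'); last by move=> b bs; apply: Hs; rewrite inE bs orbT.
rewrite tE !cup_seq_cat /=; elim: t1 {tE st'} => //= b t1 <-.
exact: cup_leftC.
Qed.

End CupAlgebra.

(** * Periodic log-concave sequences *)

Lemma log_concave_first_ratio (R : realFieldType) (a : nat -> R) (k : nat) :
  (0 < k)%N -> (forall i, (i <= k.+1)%N -> 0 < a i) ->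
  (forall i, (i < k)%N -> a i * a i.+2 <= a i.+1 ^+ 2) ->
  a 0%N = a k -> a 1%N = a k.+1 -> a 1%N = a 0%N.
Proof.
move=> k0 apos lc a0k a1k.
(* Log-concavity makes the ratios a_(i+1) / a_i nonincreasing; this is the cross-multiplied form. *)
have ratio i j : (i <= j <= k)%N -> a j.+1 * a i <= a i.+1 * a j.
  move=> /andP[ij jk]; elim: j ij jk => [|j IH]; first by rewrite leqn0 => /eqP ->.
  rewrite leq_eqVlt => /predU1P[<-//|ij] jk.
  have {}IH := IH ij (ltnW jk).
  have p0 : 0 < a j by apply: apos; lia.
  have p1 : 0 < a j.+1 by apply: apos; lia.
  have p3 : 0 < a i by apply: apos; lia.
  rewrite -(ler_pM2l p0).
  by have := ler_wpM2l (ltW p1) IH; have := ler_wpM2r (ltW p3) (lc j jk); lra.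
have p0 : 0 < a 0%N by exact: apos.
(* The ratios at 0 and at k agree by the two periodicity hypotheses, so all ratios between them are
   equal and the sequence is geometric. *)
have geo i : (i <= k)%N -> a i.+1 * a 0%N = a 1%N * a i.
  move=> ik; apply/eqP; rewrite eq_le ratio //=.
  by have := @ratio i k; rewrite ik leqnn -a0k -a1k => /(_ isT).
pose q := a 1%N / a 0%N.
have geoq i : (i <= k.+1)%N -> a i = q ^+ i * a 0%N.
  elim: i => [|i IH] ik; first by rewrite mul1r.
  apply: (mulIf (lt0r_neq0 p0)); rewrite geo // IH 1?ltnW // exprS /q.
  by field; rewrite gt_eqF.
(* Since a_0 = a_k, the common ratio q is a nonnegative k-th root of 1, hence 1. *)
have : q ^+ k == 1.
  rewrite -(inj_eq (mulIf (lt0r_neq0 p0))) -geoq // mul1r -a0k.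
  by rewrite eqxx.
rewrite pexpr_eq1 //; last by rewrite divr_ge0 // ltW // apos.
by move=> /eqP q1; rewrite (geoq 1%N) // q1 expr1n mul1r.
Qed.

(** The previous lemma, applied to the sequence and to its reversal, makes the first and the last
    ratio equal to 1. By log-concavity the former makes the sequence nonincreasing, the latter
    nondecreasing. *)
Lemma log_concave_periodic (R : realFieldType) (a : nat -> R) (k d : nat) :
  (0 < k < d)%N -> (forall i, (i <= d)%N -> 0 < a i) ->
  (forall i, (i.+2 <= d)%N -> a i * a i.+2 <= a i.+1 ^+ 2) ->
  (forall j, (j <= d - k)%N -> a (k + j)%N = a j) ->
  forall i, (i <= d)%N -> a i = a 0%N.
Proof.
move=> /andP[k0 kd] apos lc per.
have first : a 1%N = a 0%N.
  apply: (@log_concave_first_ratio _ a k) => //.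
  - by move=> i ik; apply: apos; lia.
  - by move=> i ik; apply: lc; lia.
  - by have := per 0%N (leq0n _); rewrite addn0.
  - by have := per 1%N; rewrite addn1 => -> //; rewrite subn_gt0.
have last : a d.-1 = a d.
  pose b i := a (d - i)%N.
  suff : b 1%N = b 0%N by rewrite /b subn0 subn1.
  apply: (@log_concave_first_ratio _ b k) => //.
  - by move=> i ik; apply: apos; lia.
  - move=> i ik; rewrite mulrC; have := lc (d - i.+2)%N.
    rewrite (_ : (d - i.+2).+2 = d - i)%N; last by lia.
    rewrite (_ : (d - i.+2).+1 = d - i.+1)%N; last by lia.
    by apply; lia.
  - by rewrite /b subn0 -(per (d - k)%N) // subnKC // ltnW.
  - rewrite /b -(per (d - k.+1)%N); last by lia.
    by congr a; lia.
have up i : (i < d)%N -> a i.+1 <= a i.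
  elim: i => [|i IH] id; first by rewrite first.
  have {}IH := IH (ltnW id); have := lc i id.
  have p0 : 0 < a i by apply: apos; lia.
  have p1 : 0 < a i.+1 by apply: apos; lia.
  by nra.
have down j : (j < d)%N -> a (d - j)%N >= a (d - j.+1)%N.
  elim: j => [|j IH] jd; first by rewrite subn0 subn1 last.
  have {}IH := IH (ltnW jd); have := lc (d - j.+2)%N.
  rewrite (_ : (d - j.+2).+2 = d - j)%N; last by lia.
  rewrite (_ : (d - j.+2).+1 = d - j.+1)%N; last by lia.
  have p0 : 0 < a (d - j)%N by apply: apos; lia.
  have p1 : 0 < a (d - j.+1)%N by apply: apos; lia.
  by move=> /(_ ltac:(lia)); nra.
elim=> [//|i IH] id; rewrite -IH 1?ltnW //; apply/eqP; rewrite eq_le up //=.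
have := down (d - i.+1)%N.
rewrite (_ : d - (d - i.+1) = i.+1)%N; last by lia.
by rewrite (_ : d - (d - i.+1).+1 = i)%N; last lia; apply; lia.
Qed.

(** Sorts a word in two letters, so that a symmetric function of the word depends only on the number
    of occurrences of each. *)
Lemma perm_count_bool (u : seq bool) :
  perm_eq u (nseq (size u - count id u) false ++ nseq (count id u) true).
Proof.
apply/permP => p; rewrite count_cat !count_nseq.
elim: u => [|b u IH] /=; first by rewrite !muln0.
have h := count_size id u; rewrite IH.
case: b => /=; last by rewrite add0n subSn // mulnS; lia.
by rewrite add1n subSS mulnS; lia.
Qed.

(** * Symmetric multilinear forms with a Hodge inequality, and limits of the cone [K] *)

Section LorentzianForms.
Context (R : realType) (V : lmodType R) (D K : set V) (P : seq V -> R) (d : nat).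

Definition list_in (S : set V) (s : seq V) := forall a, a \in s -> S a.

Lemma list_in_cons (S : set V) a s : list_in S (a :: s) <-> S a /\ list_in S s.
Proof.
split=> [Ss|[Sa Ss] b]; last by rewrite inE => /predU1P[->|/Ss].
by split=> [|b bs]; apply: Ss; rewrite inE ?eqxx ?bs ?orbT.
Qed.

Lemma list_in_cat (S : set V) s t : list_in S (s ++ t) <-> list_in S s /\ list_in S t.
Proof.
split=> [Ss|[Ss St] b]; last by rewrite mem_cat => /orP[/Ss|/St].
by split=> b bs; apply: Ss; rewrite mem_cat bs ?orbT.
Qed.

Lemma list_in_nseq (S : set V) k a : S a -> list_in S (nseq k a).
Proof. by move=> Sa b; rewrite mem_nseq => /andP[_ /eqP ->]. Qed.

Lemma list_in_map (T : eqType) (S : set V) (f : T -> V) w :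
  (forall t, t \in w -> S (f t)) -> list_in S (map f w).
Proof. by move=> h b /mapP[t /h Sft ->]. Qed.

Definition lin (m : nat) (e : 'I_m -> V) (b : 'rV[R]_m) : V := \sum_i b 0 i *: e i.

(** The limit is taken in the parameter space of a finite family in [D], so V carries no topology.
    The family may be linearly dependent; a single vector suffices to see that [K] is contained in
    its closure. *)
Definition kclosure : set V := [set a | exists (m : nat) (e : 'I_m -> V) (b : 'rV[R]_m),
  [/\ forall i, D (e i), a = lin e b & closure [set b' | K (lin e b')] b]].

Context (D0 : D 0) (D_lin : forall r a b, D a -> D b -> D (r *: a + b)) (KD : K `<=` D).
Context (P_lin : forall r a b s, P ((r *: a + b) :: s) = r * P (a :: s) + P (b :: s)).
Context (P_perm : forall s t, list_in D s -> perm_eq s t -> P s = P t).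

Lemma P0 s : P (0 :: s) = 0.
Proof.
have := P_lin 1 0 0 s; rewrite scaler0 addr0 mul1r => h.
by apply: (addrI (P (0 :: s))); rewrite addr0 -h.
Qed.

Lemma P_sum m (e : 'I_m -> V) b s : P (lin e b :: s) = \sum_i b 0 i * P (e i :: s).
Proof.
apply: (big_ind2 (fun x y => P (x :: s) = y)) => [|x1 x2 y1 y2 h1 h2|i _].
- exact: P0.
- by rewrite -[x1]scale1r P_lin mul1r h1 h2.
- by rewrite -[_ *: _]addr0 P_lin P0 addr0.
Qed.

Lemma PB a b s : P (a - b :: s) = P (a :: s) - P (b :: s).
Proof. by rewrite addrC -scaleN1r P_lin mulN1r addrC. Qed.

Lemma D_lin_comb m (e : 'I_m -> V) b : (forall i, D (e i)) -> D (lin e b).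
Proof.
move=> De; apply: (big_ind D) => [//|x y Dx Dy|i _].
  by rewrite -[x]scale1r; exact: D_lin.
by rewrite -[_ *: _]addr0; exact: D_lin.
Qed.

Lemma DB a b : D a -> D b -> D (a - b).
Proof. by move=> Da Db; rewrite addrC -scaleN1r; exact: D_lin. Qed.

Lemma kclosureD : kclosure `<=` D.
Proof. by move=> a [m [e [b [De -> _]]]]; exact: D_lin_comb. Qed.

Lemma sub_kclosure : K `<=` kclosure.
Proof.
move=> a Ka; have la : lin (fun _ : 'I_1 => a) (const_mx 1) = a.
  by rewrite /lin big_ord1 mxE scale1r.
exists 1%N, (fun=> a), (const_mx 1); split=> // [i|]; first exact: KD.
by apply: subset_closure; rewrite /= la.
Qed.

Lemma list_in_sub (S S' : set V) s : S `<=` S' -> list_in S s -> list_in S' s.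
Proof. by move=> sS Ss a /Ss /sS. Qed.

(* [None] marks the positions at which the varying class is inserted. *)
Definition fill (a : V) (w : seq (option V)) : seq V := map (odflt a) w.

Definition slots_in (w : seq (option V)) := forall a, Some a \in w -> D a.

Lemma list_in_fill w a : slots_in w -> D a -> list_in D (fill a w).
Proof. by move=> wD Da; apply: list_in_map => -[b /wD|]. Qed.

Lemma slots_in_cons o w : slots_in (o :: w) ->
  slots_in w /\ (forall a, o = Some a -> D a).
Proof.
move=> wD; split=> [a aw|a oa]; apply: wD; first by rewrite inE aw orbT.
by rewrite oa mem_head.
Qed.

(** Induction on w: its first letter is moved by symmetry into [s], and an open slot is first
    expanded linearly, which contributes a coordinate of b as a factor. *)
Lemma P_fill_continuous m (e : 'I_m -> V) w s :
  (forall i, D (e i)) -> slots_in w -> list_in D s ->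
  continuous (fun b => P (fill (lin e b) w ++ s)).
Proof.
move=> De; elim: w s => [|o w IH] s wD sD; first by move=> b; exact: (@cst_continuous _ R^o (P s)).
have [{}wD oD] := slots_in_cons wD.
have fD b : list_in D (fill (lin e b) w).
  by apply: list_in_fill => //; exact: D_lin_comb.
have move_head a b : D a ->
    P (a :: fill (lin e b) w ++ s) = P (fill (lin e b) w ++ a :: s).
  move=> Da; apply: P_perm.
    by apply/list_in_cons; split=> //; apply/list_in_cat.
  by rewrite perm_sym; exact: permEl (perm_catCA _ [:: a] s).
case: o oD => [a|] oD.
  rewrite (_ : (fun b => _) = (fun b => P (fill (lin e b) w ++ a :: s))).
    by apply: IH => //; apply/list_in_cons; split=> //; exact: oD.
  by apply/funext => b; rewrite -move_head //; exact: oD.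
rewrite (_ : (fun b => _) =
    \sum_i (fun b : 'rV[R]_m => b 0 i * P (fill (lin e b) w ++ e i :: s))).
  apply: (big_ind (fun f : 'rV[R]_m -> R => continuous f)) => [|f g cf cg b|i _ b].
  - by move=> b; exact: (@cst_continuous _ R^o 0).
  - exact: continuousD (cf b) (cg b).
  - apply: continuousM; first exact: coord_continuous.
    by apply: IH => //; apply/list_in_cons.
apply/funext => b; rewrite fct_sumE P_sum; apply: eq_bigr => i _.
by rewrite move_head.
Qed.

(** Continuity along finite linear parametrizations, the notion matching [kclosure]. *)
Definition poly_continuous (F : V -> R) := forall m (e : 'I_m -> V),
  (forall i, D (e i)) -> continuous (fun b => F (lin e b)).

Lemma poly_continuous_cst r : poly_continuous (fun=> r).
Proof. by move=> m e _ b; exact: (@cst_continuous _ R^o r). Qed.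

Lemma poly_continuous_fill w : slots_in w -> poly_continuous (fun a => P (fill a w)).
Proof.
move=> wD m e De; have := P_fill_continuous De wD (s := [::]).
rewrite (_ : (fun b => P (_ ++ [::])) = (fun b => P (fill (lin e b) w))); first exact.
by apply/funext => b; rewrite cats0.
Qed.

Lemma poly_continuousM F G : poly_continuous F -> poly_continuous G ->
  poly_continuous (fun a => F a * G a).
Proof. by move=> cF cG m e De b; apply: continuousM; [exact: cF|exact: cG]. Qed.

Lemma poly_continuousB F G : poly_continuous F -> poly_continuous G ->
  poly_continuous (fun a => F a - G a).
Proof.
by move=> cF cG m e De b; apply: (@continuousB _ _ _ (F \o lin e) (G \o lin e));
  [exact: cF|exact: cG].
Qed.

Lemma poly_continuous_max F G : poly_continuous F -> poly_continuous G ->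
  poly_continuous (fun a => Num.max (F a) (G a)).
Proof.
by move=> cF cG m e De b; apply: (@continuous_max _ _ (F \o lin e) (G \o lin e));
  [exact: cF|exact: cG].
Qed.

(** A negative value at the limit would persist on a neighbourhood, which meets [K]. *)
Lemma kclosure_ge0 F a : poly_continuous F -> (forall x, K x -> 0 <= F x) ->
  kclosure a -> 0 <= F a.
Proof.
move=> cF F0 [m [e [b [De -> clb]]]]; rewrite leNgt; apply/negP => Fb.
have [b' [/= Kb' Fb']] := clb _ (cvgr_lt _ (cF m e De b) _ Fb).
by have := F0 _ Kb'; rewrite leNgt Fb'.
Qed.

Context (P_gt0 : forall s, size s = d -> list_in K s -> 0 < P s).
Context (P_hodge : forall x y s, (size s).+2 = d -> K x -> D y -> list_in K s ->
  P [:: x, x & s] * P [:: y, y & s] <= P [:: x, y & s] ^+ 2).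

(** The difference of the two sides is continuous in each class separately, so classes pass to the
    closure one at a time: first the letters of s, with the first argument kept in [K], and finally
    x. *)
Lemma hodge_kclosure x y s : (size s).+2 = d -> kclosure x -> D y ->
  list_in kclosure s -> P [:: x, x & s] * P [:: y, y & s] <= P [:: x, y & s] ^+ 2.
Proof.
move=> sd Cx Dy Cs; have CD := kclosureD.
(* [s1] holds the letters already in the closure and [s2] those still in [K]. *)
have aux x' s1 s2 : (size (s1 ++ s2)).+2 = d -> K x' -> list_in kclosure s1 ->
    list_in K s2 -> P [:: x', x' & s1 ++ s2] * P [:: y, y & s1 ++ s2] <=
                    P [:: x', y & s1 ++ s2] ^+ 2.
  elim: s1 s2 => [|g s1 IH] s2 s12d Kx' /= => [_ Ks2|/list_in_cons[Cg Cs1] Ks2].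
    exact: P_hodge.
  have D12 : list_in D (s1 ++ s2).
    by apply/list_in_cat; split; [exact: list_in_sub Cs1|exact: list_in_sub Ks2].
  have Dx' := KD Kx'.
  have tail_slots p q : D p -> D q ->
      slots_in [:: Some p, Some q, None & map some (s1 ++ s2)].
    move=> Dp Dq a; rewrite !inE => /or3P[/eqP[->]//|/eqP[->]//|/=].
    by rewrite mem_map; [exact: D12|move=> ? ? []].
  have fillE a p q :
      fill a [:: Some p, Some q, None & map some (s1 ++ s2)] = [:: p, q, a & s1 ++ s2].
    by rewrite /fill /= -map_comp map_id.
  rewrite -subr_ge0.
  pose F a := P [:: x', y, a & s1 ++ s2] * P [:: x', y, a & s1 ++ s2] -
    P [:: x', x', a & s1 ++ s2] * P [:: y, y, a & s1 ++ s2].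
  apply: (kclosure_ge0 (F := F) (a := g)) => //.
    have c p q : D p -> D q -> poly_continuous (fun a => P [:: p, q, a & s1 ++ s2]).
      move=> Dp Dq; have := poly_continuous_fill (tail_slots p q Dp Dq).
      by congr poly_continuous; apply/funext => a; rewrite fillE.
    by apply: poly_continuousB; apply: poly_continuousM; exact: c.
  move=> a Ka; rewrite subr_ge0 -expr2.
  have mv p q : D p -> D q -> P [:: p, q, a & s1 ++ s2] = P [:: p, q & s1 ++ a :: s2].
    move=> Dp Dq; apply: P_perm.
      by do !(apply/list_in_cons; split=> //); exact: KD.
    by rewrite !perm_cons perm_sym; exact: permEl (perm_catCA _ [:: a] s2).
  rewrite !mv //; apply: IH => //.
    by move: s12d; rewrite /= !size_cat /= addnS.
  by apply/list_in_cons.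
have Ds : list_in D s by exact: list_in_sub Cs.
rewrite -subr_ge0.
pose F a := P [:: a, y & s] * P [:: a, y & s] - P [:: a, a & s] * P [:: y, y & s].
apply: (kclosure_ge0 (F := F) (a := x)) => //.
  have fillE a o1 o2 :
      fill a [:: o1, o2 & map some s] = [:: odflt a o1, odflt a o2 & s].
    by rewrite /fill /= -map_comp map_id.
  have c o1 o2 : o1 = None \/ o1 = Some y -> o2 = None \/ o2 = Some y ->
      poly_continuous (fun a => P [:: odflt a o1, odflt a o2 & s]).
    move=> h1 h2; have sl : slots_in [:: o1, o2 & map some s].
      move=> a; rewrite !inE => /or3P[/eqP ao|/eqP ao|].
      - by case: h1; rewrite -ao // => -[->].
      - by case: h2; rewrite -ao // => -[->].
      - by rewrite mem_map; [exact: Ds|move=> ? ? []].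
    have := poly_continuous_fill sl.
    by congr poly_continuous; apply/funext => a; rewrite fillE.
  apply: poly_continuousB; apply: poly_continuousM;
    [apply: (c None (Some y))|apply: (c None (Some y))
    |apply: (c None None)|apply: (c (Some y) (Some y))]; by [left|right].
move=> a Ka; rewrite subr_ge0 -expr2.
by have := aux a s [::]; rewrite cats0; apply => // b.
Qed.

(** Equality case. The Hodge inequality for x and r v + y has a left side affine in r, with slope 2
    P(x,x,s) P(v,y,s), and a right side free of r; hence the slope is zero. *)
Lemma hodge_null x v s : (size s).+2 = d -> kclosure x -> list_in kclosure s -> D v ->
  0 < P [:: x, x & s] -> P [:: x, v & s] = 0 -> P [:: v, v & s] = 0 ->
  forall y, D y -> P [:: v, y & s] = 0.
Proof.
move=> sd Cx Cs Dv xx0 xv vv y Dy; have CD := kclosureD.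
have Ds : list_in D s by exact: list_in_sub Cs.
have swap a b : D a -> D b -> P [:: a, b & s] = P [:: b, a & s].
  move=> Da Db; apply: P_perm; first by do !(apply/list_in_cons; split=> //).
  exact: permEl (perm_catCA [:: a] [:: b] s).
apply/eqP/negP => /negP vy.
have ineq r : P [:: x, x & s] * (2 * r * P [:: v, y & s] + P [:: y, y & s]) <=
    P [:: x, y & s] ^+ 2.
  have Dz : D (r *: v + y) by exact: D_lin.
  have := hodge_kclosure sd Cx Dz Cs.
  rewrite (swap x (r *: v + y)) ?P_lin; [|exact: CD|by []].
  rewrite (swap v (r *: v + y)) // (swap y (r *: v + y)) // !P_lin.
  rewrite (swap v x) ?xv; [|by []|exact: CD].
  rewrite (swap y x) ?(swap y v) ?vv; [|by []|by []|by []|exact: CD].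
  by congr (_ <= _); ring.
(* This r makes the left side exceed the right side by exactly 1. *)
have := ineq ((P [:: x, y & s] ^+ 2 - P [:: x, x & s] * P [:: y, y & s] + 1) /
  (2 * P [:: x, x & s] * P [:: v, y & s])).
set q := _ ^+ 2; set p := P [:: x, x & s] in xx0 *.
set z := P [:: y, y & s]; set w := P [:: v, y & s] in vy *.
have -> : p * (2 * ((q - p * z + 1) / (2 * p * w)) * w + z) = q + 1.
  by field; rewrite vy gt_eqF.
by rewrite leNgt ltrDl ltr01.
Qed.

Context (d_ge2 : (2 <= d)%N).

(* By the Hodge inequality, in a word with minimal intersection number a letter may be
   replaced by another letter of the word without losing minimality. *)
Lemma word_ge_K (T : finType) (L : T -> V) c w : (forall t, K (L t)) ->
  (forall t, c <= P (nseq d (L t))) -> size w = d -> c <= P (map L w).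
Proof.
move=> KL Lc wd; have KLs u : list_in K (map L u) by exact: list_in_map.
pose wt : d.-tuple T := tcast wd (in_tuple w).
pose u : d.-tuple T := [arg min_(u < wt) P (map L u)]%O.
have umin (u' : seq T) : size u' = d -> P (map L u) <= P (map L u').
  move=> u'd; rewrite /u; case: arg_minP => // i _ /(_ (tcast u'd (in_tuple u')) isT).
  by rewrite val_tcast.
apply: le_trans (umin _ wd).
(* A minimal word starts with a block of letters t. Each round turns the next letter x into t: the
   Hodge inequality bounds P(t,t,s) P(x,x,s) by the square of the minimum, and neither factor is
   below the minimum. The process ends at a pure power of t. *)
have red i t u' : (i.+1 + size u')%N = d ->
    P (map L (nseq i.+1 t ++ u')) = P (map L u) -> c <= P (map L u).
  elim: u' i => [|x u' IH] i.
    by rewrite addn0 cats0 => -> <-; rewrite map_nseq.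
  move=> id e; pose s := nseq i t ++ u'.
  have sd : (size s).+2 = d by rewrite size_cat size_nseq -id /= addSn addnS.
  have xs : P (map L [:: t, x & s]) = P (map L u).
    rewrite -e; apply: P_perm; first exact: list_in_sub (KLs _).
    by apply: perm_map; rewrite /= perm_cons; exact: permEl (perm_catCA [:: x] _ _).
  apply: (IH i.+1); first by rewrite -id /= addnS addSn.
  have pos : 0 < P (map L [:: t, t & s]) by apply: P_gt0; rewrite ?size_map.
  have h := P_hodge (x := L t) (y := L x) (s := map L s).
  rewrite size_map in h; have {h} := h sd (KL t) (KD (KL x)) (KLs s).
  rewrite -!map_cons xs => h.
  have m0 : 0 < P (map L u) by apply: P_gt0; rewrite ?size_map ?size_tuple.
  have mx : P (map L u) <= P (map L [:: x, x & s]) by apply: umin.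
  apply/eqP; rewrite eq_le umin; last by rewrite /= -/s sd.
  rewrite andbT -(ler_pM2r m0) -expr2; apply: le_trans h.
  by rewrite ler_pM2l.
case uE : (val u) => [|t u']; first by have := size_tuple u; rewrite uE /=; lia.
rewrite -uE; apply: (red 0%N t u'); rewrite /= ?uE //.
by have := size_tuple u; rewrite uE.
Qed.

(** [U] lists the letters allowed to lie only in the closure; the induction lets one more letter u
    leave [K]. *)
Lemma word_ge (T : finType) (L : T -> V) c (U : seq T) w :
  (forall t, kclosure (L t)) -> (forall t, t \notin U -> K (L t)) ->
  (forall t, c < P (nseq d (L t))) -> size w = d -> c <= P (map L w).
Proof.
elim: U L => [|u U IH] L CL KL Lc wd.
  by apply: word_ge_K => // t; [exact: KL|exact/ltW/Lc].
pose upd a t := if t == u then a else L t.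
pose slot t := if t == u then None else Some (L t).
have updE a : map (upd a) w = fill a (map slot w).
  by rewrite /fill -map_comp; apply: eq_map => t; rewrite /upd /slot /=; case: eqP.
have nseqE a : nseq d a = fill a (nseq d None) by rewrite /fill map_nseq.
have updL : upd (L u) =1 L by move=> t; rewrite /upd; case: eqP => // ->.
(* The maximum encodes an implication as a closed condition: either the d-th power of a is at most
   c, or the bound on the word holds. At the limit the strict hypothesis rules out the first
   alternative. *)
pose F a := Num.max (P (map (upd a) w) - c) (c - P (nseq d a)).
have : 0 <= F (L u).
  apply: kclosure_ge0 => //.
    apply: poly_continuous_max; apply: poly_continuousB;
      try exact: poly_continuous_cst.
    - rewrite (_ : (fun a => _) = fun a => P (fill a (map slot w))).
        apply: poly_continuous_fill => a /mapP[t _]; rewrite /slot.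
        by case: eqP => // _ [->]; exact: kclosureD.
      by apply/funext => a; rewrite updE.
    - rewrite (_ : (fun a => _) = fun a => P (fill a (nseq d None))).
        by apply: poly_continuous_fill => a; rewrite mem_nseq andbF.
      by apply/funext => a; rewrite nseqE.
  move=> a Ka; rewrite /F le_max !subr_ge0.
  have [ca|_] := ltP c (P (nseq d a)); last by rewrite orbT.
  rewrite IH // => t; rewrite /upd; case: eqP => // tu.
  - exact: sub_kclosure.
  - by move=> tU; apply: KL; rewrite inE negb_or tU andbT; apply/eqP.
rewrite /F le_max !subr_ge0 [X in _ || X]leNgt Lc orbF.
by rewrite (eq_map updL).
Qed.

(** The bound c is half the least pure power, as [word_ge] asks for a strict inequality; the least
    one exists because [T] is finite. *)
Lemma word_gt0 (T : finType) (L : T -> V) w : (forall t, kclosure (L t)) ->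
  (forall t, 0 < P (nseq d (L t))) -> size w = d -> 0 < P (map L w).
Proof.
move=> CL L0 wd; case: (w) wd => [|t0 w'] wd; first by move: d_ge2; rewrite -wd.
pose t1 := [arg min_(t < t0) P (nseq d (L t))]%O.
have m0 : 0 < P (nseq d (L t1)) / 2 by rewrite divr_gt0.
apply: (lt_le_trans m0); apply: (word_ge (U := enum T)) => // t.
  by rewrite mem_enum.
have : P (nseq d (L t1)) <= P (nseq d (L t)).
  by rewrite /t1; case: arg_minP => // i _; exact.
by have := L0 t1; lra.
Qed.

Context (P_nondeg : forall v s, (size s).+2 = d -> D v -> list_in K s ->
  (forall y, D y -> P [:: v, y & s] = 0) -> v = 0).

Lemma power_inj al be om k : kclosure al -> kclosure be -> K om ->
  0 < P (nseq d al) -> 0 < P (nseq d be) -> (0 < k < d)%N ->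
  (forall s, size s = (d - k)%N -> list_in D s ->
     P (s ++ nseq k al) = P (s ++ nseq k be)) ->
  al = be.
Proof.
move=> Cal Cbe Kom al0 be0 kd eqk; have CD := kclosureD.
(* Words are indexed by a finite alphabet, as [word_gt0] requires; permutations are then checked on
   the letters. *)
pose L (o : option bool) := if o is Some b then if b then al else be else om.
have CL o : kclosure (L o) by case: o => [[]|] //; exact: sub_kclosure.
have DL u : list_in D (map L u) by apply: list_in_map => o _; exact/CD/CL.
have L0 o : 0 < P (nseq d (L o)).
  case: o => [[]|] //=; apply: P_gt0; first by rewrite size_nseq.
  exact: list_in_nseq.
have Lpos u : size u = d -> 0 < P (map L u) by exact: word_gt0.
have Lperm u u' : perm_eq u u' -> P (map L u) = P (map L u').
  by move=> uu'; apply: P_perm => //; exact: perm_map.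
pose W i : seq (option bool) := nseq (d - i) (Some false) ++ nseq i (Some true).
pose a i := P (map L (W i)).
have sW i : (i <= d)%N -> size (W i) = d.
  by move=> id; rewrite size_cat !size_nseq subnK.
have a_const : forall i, (i <= d)%N -> a i = a 0%N.
  apply: (log_concave_periodic kd) => [i id|i id|j jd].
  - by apply: Lpos; exact: sW.
  - pose s := nseq (d - i.+2) (Some false) ++ nseq i (Some true).
    have sd : (size s).+2 = d by rewrite size_cat !size_nseq; lia.
    have e : forall x y i', perm_eq (W i') [:: x, y & s] -> a i' = P [:: L x, L y & map L s].
      by move=> x y i' /Lperm.
    rewrite (e (Some false) (Some false) i); last first.
      by rewrite /W (_ : d - i = (d - i.+2).+2)%N //; lia.
    rewrite (e (Some true) (Some true) i.+2); last first.
      by exact: permEl (perm_catCA _ [:: Some true; Some true] _).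
    rewrite (e (Some false) (Some true) i.+1); last first.
      rewrite /W (_ : d - i.+1 = (d - i.+2).+1)%N ?perm_cons; last by lia.
      by exact: permEl (perm_catCA _ [:: Some true] _).
    rewrite -[X in _ <= X](_ : P [:: L (Some false), L (Some true) & map L s] ^+ 2 = _) //.
    apply: hodge_kclosure; [by rewrite size_map|exact: CL|exact/CD/CL|].
    by apply: list_in_map => o _; exact: CL.
  (* Periodicity: test the hypothesis on k-th powers against d - k - j letters [be] and j letters
     [al]. *)
  - have sd : size (map L (nseq (d - (k + j)) (Some false) ++ nseq j (Some true))) = (d - k)%N.
      by rewrite size_map size_cat !size_nseq; lia.
    have nL b m : map L (nseq m (Some b)) = nseq m (L (Some b)) by rewrite map_nseq.
    have := eqk _ sd (DL _); rewrite -(nL true) -(nL false) -!map_cat => h.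
    transitivity (P (map L ((nseq (d - (k + j)) (Some false) ++ nseq j (Some true)) ++
      nseq k (Some true)))).
      by rewrite -catA -nseqD addnC.
    rewrite h; apply: Lperm; rewrite /W.
    rewrite (_ : d - j = d - (k + j) + k)%N; last by lia.
    by rewrite nseqD -!catA perm_cat2l perm_catC.
pose v := al - be.
have Dv : D v by apply: DB; exact: CD.
have bool_word (u : seq bool) : size u = d -> P (map L (map some u)) = a 0%N.
  move=> ud; rewrite (Lperm _ (W (count id u))).
    by apply: a_const; rewrite -ud count_size.
  rewrite /W -ud -!map_nseq -map_cat; apply: perm_map; exact: perm_count_bool.
have swap p q s : D p -> D q -> list_in D s -> P [:: p, q & s] = P [:: q, p & s].
  move=> Dp Dq Ds; apply: P_perm; first by do !(apply/list_in_cons; split=> //).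
  exact: permEl (perm_catCA [:: p] [:: q] s).
have Dal := CD _ Cal; have Dbe := CD _ Cbe.
(* Induction on the number j of letters [om], with the letters [al] and [be] of u arbitrary. *)
have orth j (u : seq bool) : (size u + j).+2 = d ->
    forall y, D y -> P [:: v, y & map L (map some u ++ nseq j None)] = 0.
  elim: j u => [|j IH] u uj; set s := map L _.
    rewrite cats0 in s *; rewrite addn0 in uj.
    have sd : (size s).+2 = d by rewrite !size_map.
    have bw b b' : P [:: L (Some b), L (Some b') & s] = a 0%N.
      by rewrite -(bool_word [:: b, b' & u]).
    have vb b : P [:: L (Some b), v & s] = 0.
      rewrite swap ?PB; [|by case: b|by []|exact: DL].
      by rewrite (bw true) (bw false) subrr.
    apply: (hodge_null sd (x := al)) => //.
    + by apply: list_in_map => o _; exact: CL.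
    + by rewrite (bw true true); apply: Lpos; exact: sW.
    + exact: (vb true).
    + by rewrite {1}/v PB (vb true) (vb false) subrr.
  have sd : (size s).+2 = d by rewrite size_map size_cat size_map size_nseq.
  have Ds : list_in D s by exact: DL.
  (* One letter [om] of s becomes the test vector y, and b joins the word, which then has only j
     letters [om]: the induction hypothesis applies. *)
  have om_front b : P [:: L (Some b), v & s] = 0.
    rewrite swap; [|by case: b|by []|by []].
    rewrite -(IH (b :: u) _ om) ?addSnnS //; last exact: KD.
    apply: P_perm; first by do !(apply/list_in_cons; split=> //); case: b.
    rewrite perm_cons /s.
    have -> : om = L None by [].
    rewrite -!map_cons; apply: perm_map; rewrite /= perm_sym -cat1s.
    rewrite (perm_catCA [:: None] [:: Some b]) /= perm_cons perm_sym.
    exact: permEl (perm_catCA _ [:: None] _).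
  apply: (hodge_null sd (x := al)) => //.
  + by apply: list_in_map => o _; exact: CL.
  + have := Lpos [:: Some true, Some true & map some u ++ nseq j.+1 None].
    by apply; rewrite -sd /s size_map.
  + exact: (om_front true).
  + by rewrite {1}/v PB (om_front true) (om_front false) subrr.
apply/eqP; rewrite -subr_eq0; apply/eqP.
apply: (P_nondeg (s := map L (nseq (d - 2) None))) => //.
- by rewrite size_map size_nseq; lia.
- by rewrite map_nseq; exact: list_in_nseq.
- by apply: (orth _ [::]); rewrite /=; lia.
Qed.

End LorentzianForms.

(** * Bilinear forms of Lorentzian signature *)

Section LorentzianSignature.
Context (R : realType) (n : nat) (X : complexManifold R n).
Local Notation H := (deRham X).
Context (B : H -> H -> R).
Context (B_linl : forall r a b c, B (r *: a + b) c = r * B a c + B b c).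
Context (B_linr : forall r a b c, B c (r *: a + b) = r * B c a + B c b).

Lemma B_lin_comb N (e : 'I_N -> H) x y : (forall i j, i != j -> B (e i) (e j) = 0) ->
  B (lin_comb e x) (lin_comb e y) = \sum_i x 0 i * y 0 i * B (e i) (e i).
Proof.
move=> orth.
have B0l a : B 0 a = 0.
  have := B_linl 1 0 0 a; rewrite scaler0 addr0 mul1r => h.
  by apply: (addrI (B 0 a)); rewrite addr0 -h.
have B0r a : B a 0 = 0.
  have := B_linr 1 0 0 a; rewrite scaler0 addr0 mul1r => h.
  by apply: (addrI (B a 0)); rewrite addr0 -h.
apply: (big_ind2 (fun u v => B u (lin_comb e y) = v)) => [|u1 u2 v1 v2 h1 h2|i _].
- exact: B0l.
- by rewrite -[u1]scale1r B_linl mul1r h1 h2.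
rewrite -[_ *: _]addr0 B_linl B0l addr0 -mulrA; congr (_ * _).
transitivity (\sum_j y 0 j * B (e i) (e j)); last first.
  rewrite (bigD1 i) //= big1 ?addr0 // => j ji.
  by rewrite orth ?mulr0 // eq_sym.
apply: (big_ind2 (fun u v => B (e i) u = v)) => [|u1 u2 v1 v2 h1 h2|j _].
- exact: B0r.
- by rewrite -[u1]scale1r B_linr mul1r h1 h2.
- by rewrite -[_ *: _]addr0 B_linr B0r addr0.
Qed.

(** Reverse Cauchy-Schwarz inequality: a combination of x and y without [e ord0]-component has
    nonpositive square. *)
Lemma lorentzian_hodge x y : lorentzian_signature B -> Hpp 1 x -> Hpp 1 y ->
  0 < B x x -> B x x * B y y <= B x y ^+ 2.
Proof.
move=> [N [e [[_ basis] orth pos neg]]] /basis[u [-> _]] /basis[v [-> _]].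
rewrite !B_lin_comb //; set q := fun i => B (e i) (e i).
set a := \sum_i _; set c := \sum_i _; set b := \sum_i _ => a0.
pose s := u 0 ord0; pose t := v 0 ord0.
have s0 : s != 0.
  apply: contraTneq a0 => s0; rewrite -leNgt /a big_ord_recl -/s s0 !mul0r add0r.
  by apply: sumr_le0 => i _; rewrite -expr2 mulr_ge0_le0 ?sqr_ge0 // ltW // neg.
(* [t x - s y] is orthogonal to the positive direction [e 0] *)
have : t ^+ 2 * a - 2 * s * t * b + s ^+ 2 * c <= 0.
  have -> : t ^+ 2 * a - 2 * s * t * b + s ^+ 2 * c =
      \sum_i (t * u 0 i - s * v 0 i) ^+ 2 * q i.
    rewrite !mulr_sumr -sumrB -big_split; apply: eq_bigr => i _ /=.
    by rewrite /q; ring.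
  rewrite big_ord_recl -/s -/t (mulrC t) subrr expr0n mul0r add0r.
  by apply: sumr_le0 => i _; rewrite mulr_ge0_le0 ?sqr_ge0 // ltW // neg.
have s2 : 0 < s ^+ 2 by rewrite exprn_even_gt0.
move=> le0; rewrite -subr_ge0 -(pmulr_rge0 _ s2).
(* Completing the square: s^2 (b^2 - a c) equals (t a - s b)^2 minus a times the nonpositive
   quantity. *)
have := ler_wpM2l (ltW a0) le0; have := sqr_ge0 (t * a - s * b); nra.
Qed.

(** Pairing with [e i] reads off the i-th coordinate of x times the nonzero number B(e_i, e_i). *)
Lemma lorentzian_nondegenerate x : lorentzian_signature B -> Hpp 1 x ->
  (forall y, Hpp 1 y -> B x y = 0) -> x = 0.
Proof.
move=> [N [e [[eS basis] orth pos neg]]] /basis[u [-> _]] ker.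
apply: big1 => i _; have := ker _ (eS i).
have -> : e i = lin_comb e (delta_mx 0 i).
  rewrite /lin_comb (bigD1 i) //= mxE !eqxx scale1r big1 ?addr0 // => j ji.
  by rewrite mxE (negPf ji) andbF scale0r.
rewrite B_lin_comb // (bigD1 i) //= mxE !eqxx mulr1 big1 ?addr0; last first.
  by move=> j ji; rewrite mxE (negPf ji) andbF mulr0 mul0r.
move/eqP; rewrite mulf_eq0 => /orP[/eqP ->|]; first by rewrite scale0r.
have [->|i0] := eqVneq i ord0; first by rewrite gt_eqF.
by rewrite lt_eqF // neg.
Qed.

End LorentzianSignature.

(** * Application to nef classes on a compact Kähler manifold *)

Theorem corollary5p6 (R : realType) (n : nat) (X : complexManifold R n)
    (d : nat) (Omega : deRham X) (k : nat) :
  compact_kahler X ->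
  strictly_lorentzian d Omega ->
  (1 <= k <= d - 1)%N ->
  set_inj [set alpha : deRham X | nef alpha /\ big_on d Omega alpha]
          (fun alpha => cup_exp alpha k Omega).
Proof.
move=> [_ [om Kom]] [/andP[d2 _] _ pos lor] kd al be /set_mem[nal bal] /set_mem[nbe bbe] eqk.
pose P s : R := Defs.integral X (cup_seq s Omega).
have P_lin r a b s : P (r *: a + b :: s) = r * P (a :: s) + P (b :: s).
  by rewrite /P /= cup_linl linearP.
have P_perm s t : list_in (Hpp 1) s -> perm_eq s t -> P s = P t.
  by move=> Hs st; rewrite /P (cup_seq_perm Omega Hs st).
have KD : (@kahler_class R n X) `<=` Hpp 1 by move=> a [w [w11 _] ->]; exists w.
have P_linr r a b c s : P [:: c, r *: a + b & s] = r * P [:: c, a & s] + P [:: c, b & s].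
  by rewrite /P /= cup_linl cup_linr linearP.
have P_gt0 s : size s = d -> list_in (@kahler_class R n X) s -> 0 < P s.
  move=> sd Ks; have := pos (tcast sd (in_tuple s)); rewrite val_tcast.
  by apply=> a; rewrite memtE val_tcast; exact: Ks.
have P_lor s : (size s).+2 = d -> list_in (@kahler_class R n X) s ->
    lorentzian_signature (fun a b => P [:: a, b & s]).
  move=> sd Ks; have sd' : size s = (d - 2)%N by rewrite -sd subn2.
  have := lor (tcast sd' (in_tuple s)); rewrite val_tcast.
  by apply=> a; rewrite memtE val_tcast; exact: Ks.
(* The basis of H^{1,1} in the definition of [nef] serves as the finite family. *)
have nefC a : nef a -> kclosure (Hpp 1) (@kahler_class R n X) a.
  by move=> [N [e [b [[eS _] -> clb]]]]; exists N, e, b.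
apply: (@power_inj _ _ (Hpp 1) (@kahler_class R n X) P d _ _ _ P_lin P_perm _ _ d2 _ al be (cls om) k).
- exact: Hpp0.
- exact: Hpp_lin.
- exact: KD.
- exact: P_gt0.
- move=> x y s sd Kx Dy Ks.
  apply: (lorentzian_hodge (B := fun a b => P [:: a, b & s])) => //.
  + exact: P_lor.
  + exact: KD.
  + apply: P_gt0 => //; do !(apply/list_in_cons; split=> //).
- move=> v s sd Dv Ks.
  apply: (lorentzian_nondegenerate (B := fun a b => P [:: a, b & s])) => //.
  exact: P_lor.
- exact: nefC.
- exact: nefC.
- by exists om.
- by rewrite /P -cup_exp_nseq.
- by rewrite /P -cup_exp_nseq.
- by lia.
(* The equality of classes enters only through its products with d - k further classes, integrated
   over X. *)
- by move=> s _ _; rewrite /P !cup_seq_cat -!cup_exp_nseq eqk.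
Qed.
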